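(* Let $n\ge8$ be even and let $\varphi$ be a smooth skew-morphism of $D_n$ with $\mathrm{Ker}\,\varphi=\langle a^2,b\rangle$, power function $\pi$ and order $k$. Then one of the following holds. (I) There exist integers $r,s\in\{0,\dots,n/2-1\}$, $u$ with $\gcd(u,n/2)=1$, and $e\in\{1,\dots,k-1\}$ such that for all integers $i$: $\varphi(a^{2i})=a^{2iu}$, $\varphi(a^{2i+1})=a^{2iu+2r+1}$, $\varphi(ba^{2i})=ba^{2iu+2s}$, $\varphi(ba^{2i+1})=ba^{2r+2s+2iu+1}$, and $\pi(a^{2i})\equiv\pi(ba^{2i})\equiv1$, $\pi(a^{2i+1})\equiv\pi(ba^{2i+1})\equiv e\pmod k$; and moreover: $u-1-2r\not\equiv0\pmod{n/2}$; $k$ is the smallest positive integer with $r\sigma(u,k)\equiv0$ and $s\sigma(u,k)\equiv0\pmod{n/2}$; $\gcd(e,k)=1$, $e\not\equiv1\pmod k$, $e^2\equiv1\pmod k$, $u^{e-1}\equiv1\pmod{n/2}$; $r\sigma(u,e-1)\equiv u-2r-1\pmod{n/2}$; and $s\sigma(u,e-1)\equiv -u+2r+1\pmod{n/2}$. (II) There exist integers $r,s\in\{0,\dots,n/2-1\}$, $u$ with $\gcd(u,n/2)=1$, and an odd integer $e>1$ such that $k=2(e-1)$ and for all integers $i$: $\varphi(a^{2i})=a^{2iu}$, $\varphi(a^{2i+1})=ba^{2r-2iu+1}$, $\varphi(ba^{2i})=ba^{2s+2iu}$, $\varphi(ba^{2i+1})=a^{2r-2s-2iu+1}$, and $\pi(a^{2i})\equiv\pi(ba^{2i})\equiv1$,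 $\pi(a^{2i+1})\equiv\pi(ba^{2i+1})\equiv e\pmod k$; and moreover: $u^{e-1}\equiv-1\pmod{n/2}$; $s\sigma(u,e-1)\equiv u+2r+1\pmod{n/2}$; and $r\xi(u,e-1)\equiv s\zeta(u,e-1)-1\pmod{n/2}$.
   Context: $D_n=\langle a,b\mid a^n=b^2=1,\ b^{-1}ab=a^{-1}\rangle$. A skew-morphism of a finite group $A$ is a permutation $\varphi$ of the set $A$ with $\varphi(1)=1$ for which there exists a function $\pi:A\to\mathbb{Z}_k$, where $k$ is the order of $\varphi$, such that $\varphi(xy)=\varphi(x)\varphi^{\pi(x)}(y)$ for all $x,y\in A$; $\pi$ is the power function. The kernel is $\mathrm{Ker}\,\varphi=\{x:\pi(x)=1\}$, and the core is $\mathrm{Core}\,\varphi=\bigcap_{i=1}^k\varphi^i(\mathrm{Ker}\,\varphi)$. $\varphi$ is smooth if $\varphi(x)\in x\,\mathrm{Core}\,\varphi$ for all $x$. For integers $u$ and $j\ge0$: $\sigma(u,j)=\sum_{i=1}^{j}u^{i-1}$, $\xi(u,j)=\sum_{i=1}^{j}(-u)^{i-1}$, and for even $j$, $\zeta(u,j)=\sum_{i=1}^{j/2}u^{2(i-1)}$. *)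

(* Defs.v *)
From HB Require Import structures.
From mathcomp Require Import all_boot all_order all_algebra all_fingroup.
Set Implicit Arguments. Unset Strict Implicit. Unset Printing Implicit Defensive.
Import GRing.Theory.

(* The dihedral group D_n, concretely: the pair (x, i) stands for b^x a^i,
   with x : bool and i : 'Z_n (meaningful for n >= 2). *)
Definition dihedral (n : nat) : Type := (bool * 'Z_n)%type.
HB.instance Definition _ n := Finite.on (dihedral n).

Section DihedralGroup.
Variable n : nat.
Local Open Scope ring_scope.

(* b^x a^i * b^y a^j = b^(x+y) a^((-1)^y i + j) *)
Definition dmul (g h : dihedral n) : dihedral n :=
  (addb g.1 h.1, (if h.1 then - g.2 else g.2) + h.2).
Definition done_ : dihedral n := (false, 0).
Definition dinv (g : dihedral n) : dihedral n :=
  (g.1, if g.1 then g.2 else - g.2).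

Lemma dmulA : associative dmul.
Proof.
move=> [x i] [y j] [z l]; rewrite /dmul /=; congr (_, _).
  by rewrite addbA.
by case: x; case: y; case: z => /=; rewrite ?opprD ?opprK ?addrA.
Qed.

Lemma dmul1 : left_id done_ dmul.
Proof. by move=> [x i]; rewrite /dmul /=; case: x; rewrite ?oppr0 add0r. Qed.

Lemma dmulV : left_inverse done_ dinv dmul.
Proof.
by move=> [x i]; rewrite /dmul /dinv /=; case: x => /=;
  rewrite ?addbb ?addNr ?addrN.
Qed.

End DihedralGroup.

HB.instance Definition _ n :=
  Finite_isGroup.Build (dihedral n) (@dmulA n) (@dmul1 n) (@dmulV n).

Local Open Scope group_scope.

Definition da (n : nat) : dihedral n := (false, 1%R).
Definition db (n : nat) : dihedral n := (true, 0%R).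

Definition apowz (n : nat) (z : int) : dihedral n :=
  match z with
  | Posz m => da n ^+ m
  | Negz m => (da n ^+ m.+1)^-1
  end.

(* Skew-morphisms of a finite group, with power function valued in nat
   (only its residue mod the order of phi matters). *)
Definition skew_morphism (gT : finGroupType) (phi : {perm gT}) (pi : gT -> nat) :=
  phi 1 = 1 /\ forall x y : gT, phi (x * y) = phi x * (phi ^+ pi x)%g y.

Definition skew_kernel (gT : finGroupType) (phi : {perm gT}) (pi : gT -> nat)
  : {set gT} := [set x | pi x == 1 %[mod #[phi]]]%N.

Definition skew_core (gT : finGroupType) (phi : {perm gT}) (pi : gT -> nat)
  : {set gT} :=
  \bigcap_(1 <= i < #[phi].+1) ((phi ^+ i)%g @: skew_kernel phi pi).

Definition skew_smooth (gT : finGroupType) (phi : {perm gT}) (pi : gT -> nat) :=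
  forall x : gT, phi x \in x *: skew_core phi pi.

Local Open Scope ring_scope.
Definition sigma (u : int) (j : nat) : int := \sum_(1 <= i < j.+1) u ^+ (i.-1).
Definition xi (u : int) (j : nat) : int := \sum_(1 <= i < j.+1) (- u) ^+ (i.-1).
Definition zeta (u : int) (j : nat) : int :=
  \sum_(1 <= i < (j./2).+1) u ^+ (2 * i.-1).

(* Main.v *)
Require Import Defs.
From HB Require Import structures.
From mathcomp Require Import all_boot all_order all_algebra all_fingroup.
From mathcomp Require Import cyclic ring zify.
Import GRing.Theory.
Local Open Scope group_scope.
Set Implicit Arguments.
Unset Strict Implicit.

(** Since [phi x] lies in [x * Core phi] and [Core phi] is contained in
    [K = Ker phi = <a^2, b>], [phi] preserves [K] and its other coset [aK]; it
    is an automorphism of the dihedral group [K], and [pi] takes a single value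
    [e] on [aK].  As [n / 2 >= 4], [phi (a^2) = a^(2u)] and
    [phi b = b a^(2s)], so [phi] is determined by [phi a], which is
    [a^(2r+1)] (case I) or [b a^(2r+1)] (case II).  Evaluating
    [phi (a y) = phi a * phi^e y] at [y = a^2, b, a] gives the congruences modulo
    [n / 2], and [phi^e (a y) = phi^e a * phi^(e^2) y] gives [e^2 = 1] modulo
    the order of [phi].  In case II the congruences show that
    [phi^(2(e-1)) = 1]; as [0 < e - 1 < k], this forces [k = 2(e-1)]. *)

(** * General facts on skew-morphisms and their kernels *)

Lemma kernel_skewM (gT : finGroupType) (phi : {perm gT}) (pi : gT -> nat) :
  skew_morphism phi pi ->
  forall x y : gT, x \in skew_kernel phi pi -> phi (x * y) = phi x * phi y.
Proof.
move=> [_ phiM] x y; rewrite inE => /eqP pix1.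
by rewrite phiM -(expg_mod_order phi) pix1 expg_mod_order expg1.
Qed.

(** Expanding [phi (x * y * z)] along both bracketings and cancelling shows that [phi ^+ pi (x * y)]
    and [phi ^+ pi y] agree at every [z]. *)
Lemma power_kernelM (gT : finGroupType) (phi : {perm gT}) (pi : gT -> nat) :
  skew_morphism phi pi ->
  forall x y : gT, x \in skew_kernel phi pi -> pi (x * y) = pi y %[mod #[phi]].
Proof.
move=> phiP x y Kx; apply/eqP; rewrite -eq_expg_mod_order; apply/eqP/permP => z.
have := kernel_skewM phiP (y * z) Kx.
case: (phiP) => _ phiM.
by rewrite mulgA (phiM (x * y)) (kernel_skewM phiP y) // (phiM y) mulgA => /mulgI.
Qed.

(** The last term of the intersection defining the core, at [i = #[phi]], is the kernel itself. *)
Lemma smooth_perm_coset (gT : finGroupType) (phi : {perm gT}) (pi : gT -> nat) :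
  skew_smooth phi pi -> forall x, phi x \in x *: skew_kernel phi pi.
Proof.
move=> smo x; have := smo x; apply/subsetP/mulgS.
rewrite /skew_core big_nat_recr /= ?order_gt0 //; apply: subset_trans (subsetIr _ _) _.
rewrite expg_order; apply/subsetP => _ /imsetP[y Ky ->]; by rewrite perm1.
Qed.

(** Each new application of [phi] meets a point of the orbit of [x], where [pi] is [e], and so adds
    [e] to the exponent acting on [y]. *)
Lemma skew_expgM (gT : finGroupType) (phi : {perm gT}) (pi : gT -> nat) e x :
  skew_morphism phi pi ->
  (forall j, pi ((phi ^+ j) x) = e %[mod #[phi]]) ->
  forall j (y : gT), (phi ^+ j) (x * y) = (phi ^+ j) x * (phi ^+ (e * j)) y.
Proof.
move=> [_ phiM] pix; elim=> [|j IHj] y; first by rewrite muln0 !expg0 !perm1.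
rewrite expgSr !permM IHj phiM -(expg_mod_order phi (pi _)) pix expg_mod_order.
by rewrite mulnS addnC expgD permM.
Qed.

(** * Integer congruences as equations in ['Z_m] *)

Lemma eqz_modZp (m : nat) : (1 < m)%N ->
  forall x y : int, (x = y %[mod Posz m])%Z <-> (x%:~R = y%:~R :> 'Z_m)%R.
Proof.
move=> m_gt1 x y.
have nat0 (z : nat) : (z%:R == 0 :> 'Z_m)%R = (m %| z)%N.
  by rewrite -[X in _ == X](mulr0n 1) -[RHS]/(z %% m == 0)%N -val_eqE /= !val_Zp_nat // mod0n.
have int0 (z : int) : (z%:~R == 0 :> 'Z_m)%R = (Posz m %| z)%Z.
  by case: z => z; rewrite ?NegzE ?mulrNz ?oppr_eq0 ?dvdzE ?abszN /= nat0.
split=> [/eqP|/eqP].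
  by rewrite eqz_mod_dvd -int0 rmorphB /= subr_eq0 => /eqP.
by rewrite -subr_eq0 -rmorphB /= int0 -eqz_mod_dvd => /eqP.
Qed.

Lemma coprimez_invZp m u : (1 < m)%N -> coprimez u (Posz m) ->
  exists v : int, (v%:~R * u%:~R = 1 :> 'Z_m)%R.
Proof.
move=> m_gt1 /coprimezP[[v w] /= vw]; exists v.
have m0 : ((Posz m)%:~R = 0 :> 'Z_m)%R := pchar_Zp m_gt1.
by rewrite -[RHS]/(1%:~R)%R -vw rmorphD !rmorphM /= m0 mulr0 addr0.
Qed.

(** * Dihedral elements with integer exponents *)

(** The exponent is an integer rather than a residue, so that it can be halved and treated by
    [ring]. *)
Definition drot n (x : bool) (z : int) : dihedral n := (x, z%:~R)%R.

Lemma drotM n x y z w :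
  drot n x z * drot n y w = drot n (x (+) y) ((if y then - z else z) + w)%R.
Proof.
rewrite [LHS]/(dmul _ _) /dmul /drot /=; congr (_, _).
by case: y; rewrite rmorphD //= rmorphN.
Qed.

Lemma apowzE n z : apowz n z = drot n false z.
Proof.
have nat_pow j : da n ^+ j = drot n false (Posz j).
  elim: j => // j IHj; rewrite expgSr IHj -[da n]/(drot n false 1).
  by rewrite drotM addrC -intS.
by case: z => j; rewrite /= nat_pow.
Qed.

Lemma db_apowz n z : db n * apowz n z = drot n true z.
Proof. by rewrite apowzE -[db n]/(drot n true 0) drotM add0r. Qed.

Lemma drot_val n (g : dihedral n) : g = drot n g.1 (Posz (val g.2)).
Proof. by case: g => x z; rewrite /drot /=; congr (_, _); rewrite -[LHS]natr_Zp. Qed.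

(** As [n] is even, the parity of an exponent survives reduction modulo [n]; the even exponents then
    form a subgroup containing both generators, and b^x a^(2t) = b^x (a^2)^t gives the converse. *)
Lemma mem_gen_a2b n : (1 < n)%N -> ~~ odd n -> forall x z,
  (drot n x z \in <<[set da n ^+ 2; db n]>>) = (2 %| z)%Z.
Proof.
move=> n_gt1 n_even.
have val_even x z : (2 %| Posz (val (drot n x z).2))%Z = (2 %| z)%Z.
  have /eqz_modZp : ((Posz (val (drot n x z).2))%:~R = z%:~R :> 'Z_n)%R.
    exact: natr_Zp.
  move=> /(_ n_gt1)/eqP; rewrite eqz_mod_dvd => n_dvd.
  have n2 : (2 %| Posz n)%Z by rewrite dvdzE /= dvdn2.
  by have := dvdz_trans n2 n_dvd; lia.
pose H := [set g : dihedral n | (2 %| Posz (val g.2))%Z].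
have inH x z : (drot n x z \in H) = (2 %| z)%Z by rewrite inE val_even.
have gH : group_set H.
  apply/group_setP; split=> [|g h]; first by rewrite -[1]/(drot n false 0) inH.
  rewrite (drot_val g) (drot_val h) drotM !inH => g2 h2.
  by case: ifP => _; rewrite rpredD // rpredN.
have -> : <<[set da n ^+ 2; db n]>> = H; last exact: inH.
apply/eqP; rewrite eqEsubset; apply/andP; split.
  rewrite (gen_subG _ (Group gH)) subUset !sub1set.
  rewrite -[db n]/(drot n true 0) -[da n ^+ 2]/(apowz n 2).
  by rewrite apowzE !inH.
apply/subsetP => g; rewrite (drot_val g) inH => g2.
have -> : drot n g.1 (Posz (val g.2)) = db n ^+ g.1 * (da n ^+ 2) ^+ (val g.2)./2.
  rewrite -expgM -[da n ^+ _]/(apowz n (Posz _)).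
  case: g.1; rewrite ?expg1 ?db_apowz ?expg0 ?mul1g ?apowzE; congr drot; lia.
by apply: groupM; apply: groupX; apply: mem_gen; rewrite !inE eqxx ?orbT.
Qed.

(* [dev n x z] is [b^x a^(2z)] and [dod n x z] is [b^x a^(2z+1)]. *)
Definition dev n (x : bool) (z : int) : dihedral n := drot n x (2 * z)%R.
Definition dod n (x : bool) (z : int) : dihedral n := drot n x (2 * z + 1)%R.

Lemma devM n x z y w :
  dev n x z * dev n y w = dev n (x (+) y) ((if y then - z else z) + w)%R.
Proof. by rewrite /dev drotM; congr drot; case: y; ring. Qed.

Lemma dev_dodM n x z y w :
  dev n x z * dod n y w = dod n (x (+) y) ((if y then - z else z) + w)%R.
Proof. by rewrite /dod drotM; congr drot; case: y; ring. Qed.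

Lemma dod_devM n x z y w :
  dod n x z * dev n y w = dod n (x (+) y) (if y then w - z - 1 else z + w)%R.
Proof. by rewrite /dod drotM; congr drot; case: y; ring. Qed.

Lemma dodM n x z y w :
  dod n x z * dod n y w = dev n (x (+) y) (if y then w - z else z + w + 1)%R.
Proof. by rewrite /dod drotM; congr drot; case: y; ring. Qed.

Lemma drot_eqP n : (1 < n)%N -> forall x y z w,
  drot n x z = drot n y w <-> x = y /\ (z = w %[mod Posz n])%Z.
Proof.
move=> n_gt1 x y z w; rewrite eqz_modZp // /drot.
by split=> [[-> ->]|[-> ->]].
Qed.

(** Here the modulus drops to [n./2]: the factor 2 cancels against n = 2(n/2). The offset [c] is 0
    for [dev] and 1 for [dod]. *)
Lemma eqz_mod_double n : ~~ odd n -> forall z w c : int,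
  ((2 * z + c)%R = (2 * w + c)%R %[mod Posz n])%Z <->
  (z = w %[mod Posz n./2])%Z.
Proof.
move=> n_even z w c.
have eqn : Posz n = (2 * Posz n./2)%R by move: n_even; lia.
have eqD : ((2 * z + c) - (2 * w + c) = 2 * (z - w))%R by ring.
split=> /eqP; rewrite eqz_mod_dvd ?eqD eqn => dv; apply/eqP; move: dv;
  by rewrite eqz_mod_dvd ?eqD dvdz_mul2l.
Qed.

Lemma dev_eqP n : (3 < n)%N -> ~~ odd n -> forall x y z w,
  dev n x z = dev n y w <-> x = y /\ (z%:~R = w%:~R :> 'Z_(n./2))%R.
Proof.
move=> n_gt3 n_even x y z w.
rewrite /dev drot_eqP -?eqz_modZp; try lia.
by rewrite -(eqz_mod_double n_even _ _ 0) !addr0.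
Qed.

Lemma dod_eqP n : (3 < n)%N -> ~~ odd n -> forall x y z w,
  dod n x z = dod n y w <-> x = y /\ (z%:~R = w%:~R :> 'Z_(n./2))%R.
Proof.
move=> n_gt3 n_even x y z w; rewrite /dod drot_eqP -?eqz_modZp; try lia.
by rewrite -(eqz_mod_double n_even _ _ 1).
Qed.

Lemma dihedral_evenodd n : (1 < n)%N -> ~~ odd n -> forall g : dihedral n,
  exists x (r : nat), (r < n./2)%N /\ (g = dev n x (Posz r) \/ g = dod n x (Posz r)).
Proof.
move=> n_gt1 n_even g; exists g.1, (val g.2)./2.
have gn : (val g.2 < n)%N by rewrite -[X in (_ < X)%N](Zp_cast n_gt1) ltn_ord.
split; first by lia.
case: (boolP (odd (val g.2))) => g2; [right | left];
  by rewrite [LHS]drot_val; congr drot; move: g2; lia.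
Qed.

(** * Identities for the geometric sums *)

Lemma sigmaSr u j : sigma u j.+1 = (sigma u j + u ^+ j)%R.
Proof. by rewrite /sigma big_nat_recr. Qed.

Lemma sigmaSl u j : sigma u j.+1 = (u * sigma u j + 1)%R.
Proof.
elim: j => [|j IHj]; first by rewrite /sigma big_nat1 big_geq // mulr0 add0r.
by rewrite sigmaSr {1}IHj sigmaSr exprS; ring.
Qed.

Lemma sigma0 u : sigma u 0 = 0%R.
Proof. by rewrite /sigma big_geq. Qed.

Lemma sigmaD u i j : sigma u (i + j) = (sigma u i + u ^+ i * sigma u j)%R.
Proof.
elim: j => [|j IHj]; first by rewrite addn0 sigma0 mulr0 addr0.
by rewrite addnS !sigmaSr IHj exprD; ring.
Qed.

Lemma mul_sigma u j : ((u - 1) * sigma u j = u ^+ j - 1)%R.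
Proof.
elim: j => [|j IHj]; first by rewrite sigma0 mulr0 subrr.
by rewrite sigmaSr mulrDr IHj exprS; ring.
Qed.

(** Consecutive terms pair up as u^(2i) + u^(2i+1) = (1 + u) u^(2i). Applied to [- u], this relates
    [xi] to [zeta]. *)
Lemma sigma_double u j : sigma u j.*2 = ((1 + u) * sigma (u ^+ 2) j)%R.
Proof.
elim: j => [|j IHj]; first by rewrite !sigma0 mulr0.
by rewrite doubleS !sigmaSr IHj -exprM mul2n (exprS _ j.*2); ring.
Qed.

Lemma zetaE u j : zeta u j = sigma (u ^+ 2)%R j./2.
Proof. by apply: eq_bigr => i _; rewrite exprM. Qed.

(* [q] separates the cases: [phi a = a^(2r+1)] if [q = false] and
   [phi a = b a^(2r+1)] if [q = true]. *)
Record smooth_data n (phi : {perm dihedral n}) (pi : dihedral n -> nat)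
    (q : bool) (r s : nat) (u : int) (e : nat) : Prop := SmoothData {
  sd_r : (r < n./2)%N;
  sd_s : (s < n./2)%N;
  sd_u : coprimez u (Posz n./2);
  sd_e : (0 < e <= #[phi])%N;
  sd_dev : forall j x z, (phi ^+ j) (dev n x z) =
    dev n x (z * u ^+ j + if x then Posz s * sigma u j else 0)%R;
  sd_devM : forall j x z y,
    (phi ^+ j) (dev n x z * y) = (phi ^+ j) (dev n x z) * (phi ^+ j) y;
  sd_dod0 : phi (dod n false 0) = dod n q (Posz r);
  sd_dod0M : forall y,
    phi (dod n false 0 * y) = dod n q (Posz r) * (phi ^+ e) y;
  sd_pi_dev : forall x z, pi (dev n x z) = 1 %[mod #[phi]];
  sd_pi_dod : forall x z, pi (dod n x z) = e %[mod #[phi]];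
  sd_e1 : e <> 1 %[mod #[phi]];
  sd_ee : e ^ 2 = 1 %[mod #[phi]] }.

(** * Extraction of the parameters *)

Lemma smooth_dataP n (phi : {perm dihedral n}) (pi : dihedral n -> nat) :
  (8 <= n)%N -> ~~ odd n -> skew_morphism phi pi -> skew_smooth phi pi ->
  skew_kernel phi pi = <<[set da n ^+ 2; db n]>> ->
  exists q r s u e, smooth_data phi pi q r s u e.
Proof.
move=> n_ge8 n_even phiP smo kerE.
have n_gt1 : (1 < n)%N by lia.
have n_gt3 : (3 < n)%N by lia.
set K := skew_kernel phi pi in kerE.
have Kdev x z : dev n x z \in K.
  by rewrite kerE mem_gen_a2b // dvdz_mulr.
have Kdod x z : (dod n x z \in K) = false.
  by rewrite kerE mem_gen_a2b //; lia.
(* Smoothness puts x^-1 phi(x) in [K], and [kerE] exhibits [K] as a subgroup. *)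
have Kphi x : (phi x \in K) = (x \in K).
  have := smooth_perm_coset smo x; rewrite mem_lcoset -/K kerE => xK.
  by rewrite -{1}(mulKVg x (phi x)) groupMr.
have Kphij j x : ((phi ^+ j) x \in K) = (x \in K).
  elim: j => [|j IHj]; first by rewrite perm1.
  by rewrite expgSr permM Kphi IHj.
have Kpi x : x \in K -> pi x = 1 %[mod #[phi]] by rewrite inE => /eqP.
have evP g : g \in K -> exists x (r : nat), (r < n./2)%N /\ g = dev n x (Posz r).
  have [x [r [rm [->|->]]]] := dihedral_evenodd n_gt1 n_even g; last by rewrite Kdod.
  by exists x, r.
have odP g : g \notin K -> exists x (r : nat), (r < n./2)%N /\ g = dod n x (Posz r).
  have [x [r [rm [->|->]]]] := dihedral_evenodd n_gt1 n_even g; first by rewrite Kdev.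
  by exists x, r.
have phiKM j (x y : dihedral n) : x \in K -> (phi ^+ j) (x * y) = (phi ^+ j) x * (phi ^+ j) y.
  move=> Kx; rewrite (skew_expgM phiP (e := 1%N)) ?mul1n // => i.
  by apply: Kpi; rewrite Kphij.
have phiM (x y : dihedral n) : x \in K -> phi (x * y) = phi x * phi y.
  by move=> Kx; have := phiKM 1%N x y Kx; rewrite !expg1.
(* Since b inverts a^2, this says that a^2 and b do not commute; equality would make n/2 divide
   2. *)
have noncomm : dev n false 1 <> dev n false (-1).
  move=> /(dev_eqP n_gt3 n_even)[_]; rewrite -eqz_modZp; last by lia.
  by move/eqP; rewrite eqz_mod_dvd dvdzE => /dvdn_leq -/(_ isT) /=; lia.
have phi1 : phi (dev n false 0) = dev n false 0.
  by case: phiP => h _; rewrite -[dev _ _ _]/(1 : dihedral n).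
have [x0 [u [_ phia2]]] : exists x (r : nat), (r < n./2)%N /\ phi (dev n false 1) = dev n x (Posz r).
  by apply: evP; rewrite Kphi Kdev.
have [x1 [s [s_lt phib]]] : exists x (r : nat), (r < n./2)%N /\ phi (dev n true 0) = dev n x (Posz r).
  by apply: evP; rewrite Kphi Kdev.
have [q [r [r_lt phia]]] : exists x (r : nat), (r < n./2)%N /\ phi (dod n false 0) = dod n x (Posz r).
  by apply: odP; rewrite Kphi Kdod.
(* Otherwise phi(a^2) is an involution, so phi(a^4) = phi(1) and a^4 = 1. *)
have x0F : x0 = false.
  case: x0 phia2 => // phia2; case: noncomm.
  apply: (mulgI (dev n false 1)); rewrite [in RHS]devM subrr.
  by apply: (@perm_inj _ phi); rewrite phiM // phia2 phi1 devM addNr.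
(* Otherwise phi(b) and phi(a^2) are both rotations and commute; by injectivity so do b and a^2. *)
have x1T : x1 = true.
  case: x1 phib => // phib; case: noncomm.
  apply: (mulgI (dev n true 0)); rewrite !devM /= !add0r.
  have : phi (dev n true 0 * dev n false 1) = phi (dev n false 1 * dev n true 0).
    by rewrite !phiM // phib phia2 x0F !devM addrC.
  by move/perm_inj; rewrite !devM /= add0r addr0.
rewrite {}x0F in phia2; rewrite {}x1T in phib.
have phi_nat (j : nat) : phi (dev n false (Posz j)) = dev n false (Posz j * Posz u)%R.
  elim: j => [|j IHj]; first by rewrite phi1 mul0r.
  have -> : dev n false (Posz j.+1) = dev n false (Posz j) * dev n false 1.
    by rewrite devM /=; congr dev; lia.
  by rewrite phiM // IHj phia2 devM; congr dev; lia.
have phi_evF z : phi (dev n false z) = dev n false (z * Posz u)%R.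
  case: z => j //; apply: (mulgI (phi (dev n false (Posz j.+1)))).
  rewrite -phiM // phi_nat !devM /= NegzE !mulNr !subrr phi1 //.
have phi_ev x z : phi (dev n x z) = dev n x (z * Posz u + if x then Posz s else 0)%R.
  case: x; last by rewrite addr0.
  have -> : dev n true z = dev n true 0 * dev n false z by rewrite devM add0r.
  by rewrite phiM // phib phi_evF devM addrC.
have phij_ev j x z : (phi ^+ j) (dev n x z) =
    dev n x (z * Posz u ^+ j + if x then Posz s * sigma (Posz u) j else 0)%R.
  elim: j => [|j IHj].
    by rewrite perm1 expr0 mulr1 sigma0 mulr0 if_same addr0.
  rewrite expgSr permM IHj phi_ev exprSr sigmaSl; congr dev; case: x {IHj}; ring.
have k_gt0 : (0 < #[phi])%N := order_gt0 _.
(* The representative of pi(a) is taken in 1..k rather than 0..k-1, so that [e.-1] is a true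
   predecessor. *)
pose e := ((pi (dod n false 0) + #[phi].-1) %% #[phi]).+1.
have e_pi : pi (dod n false 0) = e %[mod #[phi]].
  by rewrite /e -addn1 modnDml -addnA addn1 prednK // modnDr.
have pi_od x z : pi (dod n x z) = e %[mod #[phi]].
  have -> : dod n x z = dev n x z * dod n false 0 by rewrite dev_dodM /= addbF addr0.
  by rewrite power_kernelM.
have phi_od0 j y : (phi ^+ j) (dod n false 0 * y) = (phi ^+ j) (dod n false 0) * (phi ^+ (e * j)) y.
  apply: (skew_expgM phiP) => i.
  have : (phi ^+ i) (dod n false 0) \notin K by rewrite Kphij Kdod.
  by move/odP=> [x [t [_ ->]]].
have e_gt0 : (0 < e <= #[phi])%N by rewrite /e /= ltn_pmod.
have phi_od1 y : phi (dod n false 0 * y) = dod n q (Posz r) * (phi ^+ e) y.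
  by have := phi_od0 1%N y; rewrite !expg1 muln1 phia.
exists q, r, s, (Posz u), e; split=> //.
(* phi^k = 1 at a^2 gives u^k = 1 modulo n/2, so u^(k-1) is a Bezout coefficient for u. *)
- have u_ord : dev n false 1 = dev n false (Posz u ^+ #[phi])%R.
    by rewrite -{1}(perm1 (dev n false 1)) -(expg_order phi) phij_ev mul1r addr0.
  move/(dev_eqP n_gt3 n_even): u_ord => [_].
  rewrite -eqz_modZp; last by lia.
  move/eqP; rewrite eqz_mod_dvd => /dvdzP[c].
  rewrite -(prednK k_gt0); move: (#[phi].-1) => k cE.
  by apply/coprimezP; exists (Posz u ^+ k, c)%R; rewrite /= -cE exprSr; ring.
- by move=> j x z y; apply: phiKM.
- by move=> x z; apply: Kpi.
- move=> e1; have := Kdod false 0%R; rewrite inE.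
  by rewrite e_pi e1 eqxx.
apply/eqP; rewrite -eq_expg_mod_order expg1; apply/eqP/permP => y.
have aaE : dod n false 0 * dod n false 0 = dev n false 1 by rewrite dodM.
(* Bracketed as a(ay), the value is phi(a) phi^e(a) phi^(e^2)(y); the first two factors form
   phi(a^2), which cancels. *)
have : phi (dod n false 0 * (dod n false 0 * y)) = phi (dev n false 1) * phi y.
  by rewrite mulgA aaE phiM.
rewrite phi_od1 phi_od0 mulgA -phi_od1 aaE => /mulgI.
by rewrite mulnn.
Qed.

(** * Consequences common to both cases *)

(** Every element is in [K] or is an element of [K] times a, and powers of [phi] split off a left
    factor in [K]; so it suffices to fix [K] and a. *)
Lemma smooth_data_perm1 n (phi : {perm dihedral n}) pi q r s u e j :
  (3 < n)%N -> ~~ odd n -> smooth_data phi pi q r s u e ->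
  ((u ^+ j)%:~R = 1 :> 'Z_(n./2))%R ->
  ((Posz s * sigma u j)%:~R = 0 :> 'Z_(n./2))%R ->
  (phi ^+ j) (dod n false 0) = dod n false 0 -> phi ^+ j = 1.
Proof.
move=> n_gt3 n_even D uj sj aj.
have fix_ev x z : (phi ^+ j) (dev n x z) = dev n x z.
  rewrite (sd_dev D); apply/(dev_eqP n_gt3 n_even); split=> //.
  by rewrite rmorphD rmorphM /= uj mulr1; case: x; rewrite ?sj ?addr0.
apply/permP => g; rewrite perm1.
have [x [t [_ [->|->]]]] := dihedral_evenodd (ltnW (ltnW n_gt3)) n_even g.
  exact: fix_ev.
have -> : dod n x (Posz t) = dev n x (Posz t) * dod n false 0.
  by rewrite dev_dodM /= addbF addr0.
by rewrite (sd_devM D) fix_ev aj.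
Qed.

(** Computing phi(a a^2) = phi(a^2 a) both ways gives u^e = u, or u^e = -u when phi(a) is a
    reflection and so inverts rotations; the unit u then cancels. *)
Lemma smooth_data_power n (phi : {perm dihedral n}) pi q r s u e :
  (3 < n)%N -> ~~ odd n -> smooth_data phi pi q r s u e ->
  ((u ^+ e.-1)%:~R = (if q then -1 else 1)%:~R :> 'Z_(n./2))%R.
Proof.
move=> n_gt3 n_even D.
have e_gt0 : (0 < e)%N by case/andP: (sd_e D).
have m_gt1 : (1 < n./2)%N by lia.
have := sd_dod0M D (dev n false 1).
have -> : dod n false 0 * dev n false 1 = dev n false 1 * dod n false 0.
  by rewrite dod_devM dev_dodM /=; congr dod; ring.
have := sd_devM D 1 false 1 (dod n false 0).
rewrite !(sd_dev D) !expg1 (sd_dod0 D) => ->.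
rewrite dev_dodM dod_devM => /(dod_eqP n_gt3 n_even)[_].
rewrite -(prednK e_gt0) !mul1r !addr0 expr1 exprS /=.
have [v vu] := coprimez_invZp m_gt1 (sd_u D).
move: (e.-1) => j E.
have {}E : ((u * u ^+ j)%:~R = (if q then - u else u)%:~R :> 'Z_(n./2))%R.
  apply: (addrI (r%:R : 'Z_(n./2))%R); move: E; rewrite !rmorphD /= => <-; exact: addrC.
have := congr1 (fun t : 'Z_(n./2) => v%:~R * t)%R E; rewrite rmorphM /= mulrA vu mul1r => ->.
by case: q {D E}; rewrite ?rmorphN /= ?mulrN vu.
Qed.

(** The same comparison for a b = (b a^-2) a; the last term of [sigma u e] is u^(e-1), known from
    the previous lemma, and makes the terms in s cancel. *)
Lemma smooth_data_sigma n (phi : {perm dihedral n}) pi q r s u e :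
  (3 < n)%N -> ~~ odd n -> smooth_data phi pi q r s u e ->
  ((Posz s * sigma u e.-1)%:~R =
   ((if q then u else - u) + 2 * Posz r + 1)%:~R :> 'Z_(n./2))%R.
Proof.
move=> n_gt3 n_even D.
have e_gt0 : (0 < e)%N by case/andP: (sd_e D).
have E := smooth_data_power n_gt3 n_even D.
have := sd_dod0M D (dev n true 0).
have -> : dod n false 0 * dev n true 0 = dev n true (-1) * dod n false 0.
  by rewrite dod_devM dev_dodM /=; congr dod; ring.
have := sd_devM D 1 true (-1)%R (dod n false 0).
rewrite !(sd_dev D) !expg1 (sd_dod0 D) => ->.
rewrite dev_dodM dod_devM => /(dod_eqP n_gt3 n_even)[_].
move: E; rewrite -{2 3}(prednK e_gt0); move: (e.-1) => j E; rewrite mul0r add0r.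
rewrite !sigmaSr sigma0 expr0 add0r mulr1 mulN1r.
rewrite mulrDr.
have -> : ((Posz s * sigma u j + Posz s * u ^+ j - Posz r - 1)%:~R =
   (Posz s * sigma u j)%:~R + (Posz s)%:~R * (u ^+ j)%:~R - (Posz r)%:~R - 1 :> 'Z_(n./2))%R.
  by ring.
rewrite {}E => E; apply/eqP; rewrite -subr_eq0; apply/eqP.
(* Zero is written as the difference of the two sides of [E], which leaves a ring identity. *)
rewrite -[X in _ = X](subrr ((if q then - (- u + Posz s) else - u + Posz s) + Posz r)%:~R)%R {1}E.
by case: (q); ring.
Qed.

Lemma smooth_data_dod n (phi : {perm dihedral n}) pi q r s u e x z :
  smooth_data phi pi q r s u e ->
  phi (dod n x z) = dod n (x (+) q)
    ((if q then - (z * u + if x then Posz s else 0)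
      else z * u + if x then Posz s else 0) + Posz r)%R.
Proof.
move=> D; have -> : dod n x z = dev n x z * dod n false 0.
  by rewrite dev_dodM /= addbF addr0.
have := sd_devM D 1 x z (dod n false 0); rewrite !(sd_dev D) !expg1 (sd_dod0 D) => ->.
by rewrite dev_dodM sigmaSr sigma0 add0r expr0 mulr1 expr1.
Qed.

Lemma smooth_data_dev n (phi : {perm dihedral n}) pi q r s u e x z :
  smooth_data phi pi q r s u e ->
  phi (dev n x z) = dev n x (z * u + if x then Posz s else 0)%R.
Proof.
move=> D; have := sd_dev D 1 x z.
by rewrite expg1 sigmaSr sigma0 add0r expr0 mulr1 expr1.
Qed.

(** * Case I: phi(a) is a rotation *)

Lemma smooth_dataF_iter n (phi : {perm dihedral n}) pi r s u e j :
  smooth_data phi pi false r s u e ->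
  (phi ^+ j) (dod n false 0) = dod n false (Posz r * sigma u j)%R.
Proof.
move=> D; elim: j => [|j IHj]; first by rewrite perm1 sigma0 mulr0.
rewrite expgSr permM IHj (smooth_data_dod _ _ D) sigmaSl /=; congr dod; ring.
Qed.

(** Comparing exponents in phi(a^2) = phi(a) phi^e(a) gives u = r + r sigma(u,e) + 1, and the last
    term of sigma(u,e) is u^(e-1) = 1. *)
Lemma smooth_dataF_sigma n (phi : {perm dihedral n}) pi r s u e :
  (3 < n)%N -> ~~ odd n -> smooth_data phi pi false r s u e ->
  ((Posz r * sigma u e.-1)%:~R = (u - 2 * Posz r - 1)%:~R :> 'Z_(n./2))%R.
Proof.
move=> n_gt3 n_even D.
have e_gt0 : (0 < e)%N by case/andP: (sd_e D).
have uE := smooth_data_power n_gt3 n_even D.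
have := sd_dod0M D (dod n false 0).
rewrite dodM (smooth_data_dev _ _ D) (smooth_dataF_iter _ D) dodM /=.
move=> /(dev_eqP n_gt3 n_even)[_].
rewrite -{1}(prednK e_gt0) sigmaSr; move: (e.-1) uE => j uE E.
apply/eqP; rewrite -subr_eq0; apply/eqP.
have -> : ((Posz r * sigma u j)%:~R - (u - 2 * Posz r - 1)%:~R
  = (Posz r + Posz r * (sigma u j + u ^+ j) + 1)%:~R - ((0 + 0 + 1) * u + 0)%:~R
    + (Posz r)%:~R * (1 - (u ^+ j)%:~R) :> 'Z_(n./2))%R by ring.
by rewrite -E uE !subrr mulr0 addr0.
Qed.

(** This yields the minimality of k: the two vanishing products also force u^j = 1. *)
Lemma smooth_dataF_perm1 n (phi : {perm dihedral n}) pi r s u e j :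
  (3 < n)%N -> ~~ odd n -> smooth_data phi pi false r s u e ->
  ((Posz r * sigma u j)%:~R = 0 :> 'Z_(n./2))%R ->
  ((Posz s * sigma u j)%:~R = 0 :> 'Z_(n./2))%R ->
  phi ^+ j = 1.
Proof.
move=> n_gt3 n_even D rj sj; apply: (smooth_data_perm1 n_gt3 n_even D) => //.
  (* (u - 1) sigma(u, j) = u^j - 1, and u - 1 = r (sigma(u, e - 1) + 2). *)
  have E := smooth_dataF_sigma n_gt3 n_even D.
  apply/eqP; rewrite -subr_eq0; apply/eqP.
  have -> : ((u ^+ j)%:~R - 1 = ((u - 1) * sigma u j)%:~R :> 'Z_(n./2))%R.
    by rewrite mul_sigma rmorphB.
  have -> : (((u - 1) * sigma u j)%:~R = (sigma u e.-1 + 2)%:~R * (Posz r * sigma u j)%:~R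
    - ((Posz r * sigma u e.-1)%:~R - (u - 2 * Posz r - 1)%:~R) * (sigma u j)%:~R
    :> 'Z_(n./2))%R by ring.
  by rewrite rj E subrr mul0r mulr0 subr0.
rewrite (smooth_dataF_iter _ D); apply/(dod_eqP n_gt3 n_even); split=> //.
Qed.

(** * Case II: phi(a) is a reflection *)

(** On the coset aK, [phi] exchanges rotations and reflections, so its square is iterated; on
    rotations that is the affine map z -> u^2 z + (r - s - ru). *)
Lemma smooth_dataT_iter n (phi : {perm dihedral n}) pi r s u e j z :
  smooth_data phi pi true r s u e ->
  (phi ^+ j.*2) (dod n false z) =
  dod n false (z * u ^+ j.*2 + (Posz r - Posz s - Posz r * u) * sigma (u ^+ 2) j)%R.
Proof.
move=> D; elim: j => [|j IHj]; first by rewrite perm1 sigma0 mulr0 addr0 mulr1.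
rewrite doubleS !expgSr !permM IHj !(smooth_data_dod _ _ D) sigmaSl !exprS /=.
by congr dod; ring.
Qed.

(** For even e, phi^e(a) is a rotation, so phi(a) phi^e(a) is a reflection, whereas phi(a^2) is a
    rotation. *)
Lemma smooth_dataT_odd n (phi : {perm dihedral n}) pi r s u e :
  (3 < n)%N -> ~~ odd n -> smooth_data phi pi true r s u e -> odd e.
Proof.
move=> n_gt3 n_even D.
have := sd_dod0M D (dod n false 0); rewrite dodM (smooth_data_dev _ _ D).
case: (boolP (odd e)) => // /even_halfK <-.
by rewrite (smooth_dataT_iter _ _ D) dodM => /(dev_eqP n_gt3 n_even)[].
Qed.

(** The left side is the c with phi^(e-1)(a) = a^(2c+1). One more [phi] turns phi(a^2) = phi(a)
    phi^e(a) into u = -cu, so phi^(e-1) inverts a. *)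
Lemma smooth_dataT_zeta n (phi : {perm dihedral n}) pi r s u e :
  (3 < n)%N -> ~~ odd n -> smooth_data phi pi true r s u e ->
  (((Posz r - Posz s - Posz r * u) * zeta u e.-1)%:~R = -1 :> 'Z_(n./2))%R.
Proof.
move=> n_gt3 n_even D.
have e_odd := smooth_dataT_odd n_gt3 n_even D.
have e_eq : e = (e./2).*2.+1 by lia.
have uE := smooth_data_power n_gt3 n_even D.
have := sd_dod0M D (dod n false 0).
rewrite dodM (smooth_data_dev _ _ D) zetaE.
have -> : e.-1./2 = e./2 by lia.
rewrite {1}e_eq expgSr permM (smooth_dataT_iter _ _ D) (smooth_data_dod _ _ D) dodM /=.
move=> /(dev_eqP n_gt3 n_even)[_] E.
have m_gt1 : (1 < n./2)%N by lia.
have [v vu] := coprimez_invZp m_gt1 (sd_u D).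
set c := (_ * sigma _ _)%R; rewrite -/c in E.
have {}E : (u%:~R = - (c%:~R * u%:~R) :> 'Z_(n./2))%R.
  by move: E; rewrite !add0r mul1r addr0 => E; rewrite {1}E; ring.
have := congr1 (fun t : 'Z_(n./2) => v%:~R * t)%R E.
by rewrite mulrN mulrCA vu mulr1 => cE; rewrite [in RHS]cE opprK.
Qed.

Lemma smooth_dataT_order n (phi : {perm dihedral n}) pi r s u e :
  (3 < n)%N -> ~~ odd n -> smooth_data phi pi true r s u e ->
  #[phi] = (2 * e.-1)%N.
Proof.
move=> n_gt3 n_even D.
have e_odd := smooth_dataT_odd n_gt3 n_even D.
have uE := smooth_data_power n_gt3 n_even D.
have zE := smooth_dataT_zeta n_gt3 n_even D.
have e1 : e != 1%N by apply/eqP => e1; case: (sd_e1 D); rewrite e1.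
have phi1 : phi ^+ (2 * e.-1) = 1.
  apply: (smooth_data_perm1 n_gt3 n_even D).
  - by rewrite mulnC exprM rmorphXn /= uE -rmorphXn.
  - rewrite mul2n -addnn.
    rewrite sigmaD -[X in (X + _)%R]mul1r -mulrDl mulrCA rmorphM rmorphD /= uE.
    by rewrite subrr mul0r.
  have e2 : e.-1 = (e./2).*2 by lia.
  rewrite mul2n -addnn expgD permM {1 2}e2 !(smooth_dataT_iter _ _ D) -e2.
  move: zE; rewrite zetaE; have -> : e.-1./2 = e./2 by lia.
  move=> zE; apply/(dod_eqP n_gt3 n_even); split=> //.
  by rewrite mul0r add0r rmorphD rmorphM /= zE uE mulN1r opprK addrN.
have := order_dvdn phi (2 * e.-1); rewrite phi1 eqxx => /dvdnP[c cE].
case/andP: (sd_e D) => e_gt0 e_le.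
(* In 2(e-1) = ck, c = 0 would give e = 1 and c >= 2 would give e > k. *)
case: c cE => [|[|c]] cE; nia.
Qed.

(** * Assembly of the two alternatives *)

Unset Implicit Arguments.

Theorem theorem5 (n : nat) (phi : {perm dihedral n}) (pi : dihedral n -> nat)
    (k : nat) :
  (8 <= n)%N -> ~~ odd n ->
  skew_morphism phi pi -> skew_smooth phi pi -> k = #[phi] ->
  skew_kernel phi pi = <<[set da n ^+ 2; db n]>> ->
  let a := apowz n in let b := db n in let m := (Posz n./2) in
  (exists (r s : nat) (u : int) (e : nat),
    [/\ (r < n./2)%N, (s < n./2)%N, coprimez u m & (0 < e < k)%N] /\
    (forall i : int,
      [/\ phi (a (2 * i)%R) = a (2 * i * u)%R,
          phi (a (2 * i + 1)%R) = a (2 * i * u + 2 * (Posz r) + 1)%R,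
          phi (b * a (2 * i)%R) = b * a (2 * i * u + 2 * (Posz s))%R,
          phi (b * a (2 * i + 1)%R) = b * a (2 * (Posz r) + 2 * (Posz s) + 2 * i * u + 1)%R
        & [/\ pi (a (2 * i)%R) = 1 %[mod k], pi ((b * a (2 * i)%R)%g) = 1 %[mod k],
              pi (a (2 * i + 1)%R) = e %[mod k]
            & pi ((b * a (2 * i + 1)%R)%g) = e %[mod k]]%N]) /\
    ((u - 1 - 2 * (Posz r))%R <> 0 %[mod m])%Z /\
    ((0 < k)%N /\ ((Posz r) * sigma u k)%R = 0 %[mod m]%Z /\
                  ((Posz s) * sigma u k)%R = 0 %[mod m]%Z /\
     forall j : nat, (0 < j < k)%N ->
       ~ (((Posz r) * sigma u j)%R = 0 %[mod m]%Z /\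
          ((Posz s) * sigma u j)%R = 0 %[mod m]%Z)) /\
    [/\ coprime e k, e <> 1 %[mod k], e ^ 2 = 1 %[mod k]
      & (u ^+ e.-1)%R = 1 %[mod m]%Z]%N /\
    ((Posz r) * sigma u e.-1)%R = (u - 2 * (Posz r) - 1)%R %[mod m]%Z /\
    ((Posz s) * sigma u e.-1)%R = (- u + 2 * (Posz r) + 1)%R %[mod m]%Z)
  \/
  (exists (r s : nat) (u : int) (e : nat),
    [/\ (r < n./2)%N, (s < n./2)%N, coprimez u m, odd e & (1 < e)%N] /\
    k = (2 * e.-1)%N /\
    (forall i : int,
      [/\ phi (a (2 * i)%R) = a (2 * i * u)%R,
          phi (a (2 * i + 1)%R) = b * a (2 * (Posz r) - 2 * i * u + 1)%R,
          phi (b * a (2 * i)%R) = b * a (2 * (Posz s) + 2 * i * u)%R,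
          phi (b * a (2 * i + 1)%R) = a (2 * (Posz r) - 2 * (Posz s) - 2 * i * u + 1)%R
        & [/\ pi (a (2 * i)%R) = 1 %[mod k], pi ((b * a (2 * i)%R)%g) = 1 %[mod k],
              pi (a (2 * i + 1)%R) = e %[mod k]
            & pi ((b * a (2 * i + 1)%R)%g) = e %[mod k]]%N]) /\
    (u ^+ e.-1)%R = (- 1)%R %[mod m]%Z /\
    ((Posz s) * sigma u e.-1)%R = (u + 2 * (Posz r) + 1)%R %[mod m]%Z /\
    ((Posz r) * xi u e.-1)%R = ((Posz s) * zeta u e.-1 - 1)%R %[mod m]%Z).
Proof.
move=> n_ge8 n_even phiP smo -> kerE a b m.
have n_gt3 : (3 < n)%N by lia.
have m_gt1 : (1 < n./2)%N by lia.
have modm x y : (x%:~R = y%:~R :> 'Z_(n./2))%R -> (x = y %[mod m])%Z.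
  by move/(eqz_modZp m_gt1).
have [q [r [s [u [e D]]]]] := smooth_dataP n_ge8 n_even phiP smo kerE.
have aE i : a (2 * i)%R = dev n false i by rewrite /a apowzE.
have a1E i : a (2 * i + 1)%R = dod n false i by rewrite /a apowzE.
have bE i : b * a (2 * i)%R = dev n true i by rewrite /a /b db_apowz.
have b1E i : b * a (2 * i + 1)%R = dod n true i by rewrite /a /b db_apowz.
have piE i : [/\ pi (a (2 * i)%R) = 1 %[mod #[phi]],
    pi ((b * a (2 * i)%R)%g) = 1 %[mod #[phi]],
    pi (a (2 * i + 1)%R) = e %[mod #[phi]]
  & pi ((b * a (2 * i + 1)%R)%g) = e %[mod #[phi]]]%N.
  by rewrite bE b1E aE a1E; split; rewrite ?(sd_pi_dev D) ?(sd_pi_dod D).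
have e_e : coprime e #[phi].
  have : coprime (e ^ 2) #[phi] by rewrite -coprime_modl (sd_ee D) coprime_modl coprime1n.
  by rewrite coprime_pexpl.
have e1 : e <> 1 %[mod #[phi]] := sd_e1 D.
have /andP[e_gt0 e_le] := sd_e D.
have uE := smooth_data_power n_gt3 n_even D.
have sE := smooth_data_sigma n_gt3 n_even D.
case: q D uE sE => D uE sE; [right | left]; exists r, s, u, e.
  have e_odd := smooth_dataT_odd n_gt3 n_even D.
  split; first split; rewrite ?(sd_r D) ?(sd_s D) ?(sd_u D) //.
    by case: (e) e_gt0 e1 => [|[|]].
  split; first exact: smooth_dataT_order n_gt3 n_even D.
  split.
    move=> i; split; last exact: piE;
      rewrite ?bE ?b1E ?aE ?a1E ?(smooth_data_dev _ _ D) ?(smooth_data_dod _ _ D) /=;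
      rewrite /a /b ?db_apowz ?apowzE; congr drot; ring.
  split; first exact: modm.
  split; first exact: modm.
  apply: modm; have := smooth_dataT_zeta n_gt3 n_even D.
  (* As e - 1 is even, the doubling formula at -u applies; the claim becomes (r - s - ru) zeta =
     -1. *)
  have -> : xi u e.-1 = ((1 - u) * zeta u e.-1)%R.
    have e2 : e.-1 = (e.-1./2).*2 by lia.
    rewrite zetaE -[xi u _]/(sigma (- u)%R _) {1}e2 sigma_double; congr (_ * _)%R.
    by rewrite sqrrN.
  move=> zE; apply/eqP; rewrite -subr_eq0; apply/eqP.
  rewrite -[X in _ = X](addNr 1%R) -{1}zE; ring.
have rE := smooth_dataF_sigma n_gt3 n_even D.
have perm1F j : (Posz r * sigma u j)%R = 0 %[mod m]%Z ->
    (Posz s * sigma u j)%R = 0 %[mod m]%Z -> phi ^+ j = 1.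
  move=> /(eqz_modZp m_gt1) rj /(eqz_modZp m_gt1) sj.
  exact: (smooth_dataF_perm1 n_gt3 n_even D).
(* If e = k, then e is coprime to itself, so e = 1. *)
have e_lt : (e < #[phi])%N.
  rewrite ltn_neqAle e_le andbT; apply/eqP => ek; move: e_e.
  by rewrite -ek /coprime gcdnn => /eqP e_1; apply: e1; rewrite e_1.
split; first split; rewrite ?(sd_r D) ?(sd_s D) ?(sd_u D) ?e_gt0 //.
split.
  move=> i; split; last exact: piE;
    rewrite ?bE ?b1E ?aE ?a1E ?(smooth_data_dev _ _ D) ?(smooth_data_dod _ _ D) /=;
    rewrite /a /b ?db_apowz ?apowzE; congr drot; ring.
split.
  (* Both products at e - 1 equal u - 1 - 2r up to sign; their vanishing gives phi^(e-1) = 1,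
     against 0 < e - 1 < k. *)
  move/(eqz_modZp m_gt1) => u0.
  have phi1 : phi ^+ e.-1 = 1.
    apply: perm1F; apply: modm.
      by rewrite rE -u0; congr intmul; ring.
    rewrite sE; have -> : ((- u + 2 * Posz r + 1)%:~R =
      - (u - 1 - 2 * Posz r)%:~R :> 'Z_(n./2))%R by ring.
    by rewrite u0 oppr0.
  have := order_dvdn phi e.-1; rewrite phi1 eqxx => /dvdn_leq e_le'.
  case: (e) e_gt0 e_lt e1 e_le' => [|[|j]] //= _ lt_j _ /(_ isT).
  by rewrite leqNgt (ltnW lt_j).
split.
  split; first exact: order_gt0.
  have phik := expg_order phi.
  split.
    (* The two congruences at k express that phi^k fixes a and b. *)
    apply: modm; have := smooth_dataF_iter #[phi] D.
    by rewrite phik perm1 => /(dod_eqP n_gt3 n_even)[_ <-].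
  split.
    apply: modm; have := sd_dev D #[phi] true 0%R.
    by rewrite phik perm1 mul0r add0r => /(dev_eqP n_gt3 n_even)[_ <-].
  move=> j /andP[j_gt0 j_lt] [rj sj].
  have := order_dvdn phi j; rewrite (perm1F _ rj sj) eqxx => /(dvdn_leq j_gt0).
  by rewrite leqNgt j_lt.
split; first by split=> //; [exact: sd_ee D | exact: modm].
by split; apply: modm.
Qed.
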